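(* Let $d \ge 2$ and $n \ge d+2$ be integers. For all $2 \le i \le n$ we have, as $q\to+\infty$ over prime powers, $$|w_i(q,n,d)|\in O \left( q^{d-1+n(i-1) - \binom{i+1}{2}}\right).$$
   Context: Let $q$ be a prime power. The Hamming weight of $v \in \mathbb{F}_q^n$ is the number of its nonzero coordinates. For integers $n,d\ge 1$, the higher-weight Dowling lattice $\mathcal{H}(q,n,d)$ is the set, ordered by inclusion, of all $\mathbb{F}_q$-linear subspaces of $\mathbb{F}_q^n$ that have a basis made of vectors of Hamming weight at most $d$, together with the zero space. It is a finite geometric lattice whose rank function is the $\mathbb{F}_q$-dimension. With $\mu$ the Möbius function of $\mathcal{H}(q,n,d)$, the $i$-th Whitney number (of the first kind) is $w_i(q,n,d)=\sum_{U \in \mathcal{H}(q,n,d),\ \dim U=i} \mu(\{0\},U)$. In the asymptotic estimate the parameters $n,d,i$ are fixed constants. *)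

(* Defs.v *)
From HB Require Import structures.
From mathcomp Require Import all_boot all_order all_algebra.

Set Implicit Arguments.
Unset Strict Implicit.
Unset Printing Implicit Defensive.

Import Order.TTheory GRing.Theory Num.Theory.

Local Open Scope ring_scope.

Section Mobius.
Variables (disp : Order.disp_t) (T : finPOrderType disp).
Implicit Types x y z : T.

(* The first argument is fuel; [#|T|] suffices, since the strictly decreasing
   chains of [T] have at most [#|T|] elements ([mobiusE]). *)
Fixpoint mobius_rec (k : nat) (x y : T) : int :=
  if k is k'.+1 then
    if x == y then 1
    else if (x < y)%O then
      - \sum_(z : T | (x <= z)%O && (z < y)%O) mobius_rec k' x z
    else 0
  else 0.

Definition mobius (x y : T) : int := mobius_rec #|T| x y.

Lemma card_lt_down z y : (z < y)%O ->
  (#|[pred t : T | t <= z]%O| < #|[pred t : T | t <= y]%O|)%N.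
Proof.
move=> zy; apply: proper_card; apply/properP; split.
  by apply/subsetP => t; rewrite !inE => tz; apply: le_trans tz (ltW zy).
by exists y; rewrite !inE ?lexx ?(lt_geF zy).
Qed.

Lemma mobius_rec_stable k l x y :
  (#|[pred t : T | t <= y]%O| <= k)%N -> (#|[pred t : T | t <= y]%O| <= l)%N ->
  mobius_rec k x y = mobius_rec l x y.
Proof.
elim: k l y => [|k IHk] [|l] y //=.
- by rewrite leqn0 => /eqP/card0_eq/(_ y); rewrite !inE lexx.
- by move=> _; rewrite leqn0 => /eqP/card0_eq/(_ y); rewrite !inE lexx.
move=> yk yl; case: eqP => // _; case: ifP => // _.
congr (- _); apply: eq_bigr => z /andP[_ zy].
by apply: IHk; rewrite -ltnS; apply: leq_trans (card_lt_down zy) _.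
Qed.

Lemma mobiusE x y :
  mobius x y = if x == y then 1
               else if (x < y)%O then
                 - \sum_(z : T | (x <= z)%O && (z < y)%O) mobius x z
               else 0.
Proof.
rewrite {1}/mobius (@mobius_rec_stable _ #|T|.+1) ?max_card //.
exact/leqW/max_card.
Qed.

End Mobius.

Section FiniteVspace.
Import VectorInternalTheory.
Variables (F : finFieldType) (vT : vectType F).

HB.instance Definition _ := [Countable of {vspace vT} by <:].
HB.instance Definition _ := [Finite of {vspace vT} by <:].

End FiniteVspace.

Definition hamming_weight (F : finFieldType) (n : nat) (v : 'rV[F]_n) : nat :=
  #|[set j | v 0 j != 0]|.

(* The zero space satisfies this, with the empty tuple as its basis. *)
Definition has_light_basis (F : finFieldType) (n d : nat)
    (U : {vspace 'rV[F]_n}) : bool :=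
  [exists X : (\dim U).-tuple 'rV[F]_n,
     basis_of U X && all (fun v => hamming_weight v <= d)%N X].

(* Higher-weight Dowling lattice H(#|F|, n, d). *)
Record hwdl (F : finFieldType) (n d : nat) := Hwdl {
  hwdl_space :> {vspace 'rV[F]_n};
  _ : has_light_basis d hwdl_space
}.

HB.instance Definition _ F n d := [isSub for @hwdl_space F n d].
HB.instance Definition _ F n d := [Finite of hwdl F n d by <:].

Fact hwdl_display : Order.disp_t. Proof. exact: Order.Disp tt tt. Qed.

Section HwdlOrder.
Variables (F : finFieldType) (n d : nat).
Implicit Types U V W : hwdl F n d.

Definition hwdl_le U V : bool := (U <= V)%VS.
Definition hwdl_lt U V : bool := (V != U) && hwdl_le U V.

Fact hwdl_lt_def U V : hwdl_lt U V = (V != U) && hwdl_le U V.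
Proof. by []. Qed.

Fact hwdl_le_refl : reflexive hwdl_le.
Proof. by move=> U; apply: subvv. Qed.

Fact hwdl_le_anti : antisymmetric hwdl_le.
Proof. by move=> U V UV; apply/val_inj/eqP; rewrite eqEsubv. Qed.

Fact hwdl_le_trans : transitive hwdl_le.
Proof. by move=> V U W; apply: subv_trans. Qed.

HB.instance Definition _ := Order.isPOrder.Build hwdl_display (hwdl F n d)
  hwdl_lt_def hwdl_le_refl hwdl_le_anti hwdl_le_trans.

Fact has_light_basis0 : has_light_basis d (0%VS : {vspace 'rV[F]_n}).
Proof.
have sz0 : size ([::] : seq 'rV[F]_n) == \dim (0%VS : {vspace 'rV[F]_n}).
  by rewrite dimv0.
apply/existsP; exists (Tuple sz0) => /=.
by rewrite andbT nil_basis.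
Qed.

Definition hwdl0 : hwdl F n d := Hwdl has_light_basis0.

Fact hwdl_le0 U : (hwdl0 <= U)%O.
Proof. exact: sub0v. Qed.

HB.instance Definition _ :=
  Order.hasBottom.Build hwdl_display (hwdl F n d) hwdl_le0.

End HwdlOrder.

(* Of the first kind; the rank function of [hwdl F n d] is the dimension. *)
Definition whitney (F : finFieldType) (n d i : nat) : int :=
  \sum_(U : hwdl F n d | \dim U == i) mobius (hwdl0 F n d) U.

(* Main.v *)
Require Import Defs.
From mathcomp Require Import all_boot all_order all_algebra all_field.
From mathcomp Require Import zify.

Set Implicit Arguments.
Unset Strict Implicit.
Unset Printing Implicit Defensive.

Import Order.TTheory GRing.Theory Num.Theory.

Local Open Scope ring_scope.

(** Write W_i for the sum of |mu(0, U)| over the U of dimension i, and q for the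
    order of the field. Since |w_i| <= W_i, it is enough to bound W_i.

    In a geometric lattice, Weisner's theorem ([weisner]) applied to an atom a
    below U expresses mu(0, U) as minus the sum of mu(0, H) over the coatoms H
    of [0, U] that do not contain a. Hence |mu(0, U)| is at most the sum of
    |mu(0, H)| over the coatoms H ([abs_mobius_le]), and exchanging the two
    sums gives W_(i+1) <= W_i * N, where N bounds the number of covers of an
    H of dimension i ([abs_whitney_succ]).

    There are two bounds on that number, both obtained by counting the vectors
    in the pairwise disjoint sets U \ H. Counting light vectors, those of weight
    at most d, of which there are O(q^d) and of which each U \ H has at least q - 1, gives O(q^(d-1))
    covers ([leq_card_covers_light]). Counting all vectors gives O(q^(n-i-1))
    covers ([leq_card_covers_all]).

    Starting from W_0 = 1, two steps of the first kind give
    W_2 = O(q^(2d-2)), and this is O(q^(n+d-4)), the claimed bound at i = 2,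
    because d + 2 <= n. Each further step i - 1 -> i of the second kind
    multiplies the bound by O(q^(n-i)), which is exactly the growth of
    q^(d-1+n(i-1)-binom(i+1,2)). The second kind of step taken already from
    W_1 = O(q^(d-1)) would give W_2 = O(q^(n+d-3)), one factor q too many.

    All estimates are kept in nat by moving the negative powers of q to the
    other side. The resulting constant is 2^(2n+i), valid for every q. *)

(** * The Moebius function *)

Lemma leq_absz_sum (I : finType) (P : pred I) (f : I -> int) :
  (`|(\sum_(j | P j) f j)%R| <= \sum_(j | P j) `|f j|)%N.
Proof.
elim/big_ind2: _ => // x1 x2 y1 y2 le1 le2.
by apply: leq_trans (leq_add le1 le2); lia.
Qed.

Section Weisner.
Variables (disp : Order.disp_t) (T : finPOrderType disp).
Implicit Types x y u : T.

Lemma sum_mobius_interval x y : (x < y)%O ->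
  \sum_(z : T | (x <= z)%O && (z <= y)%O) mobius x z = 0.
Proof.
move=> xy; rewrite (bigD1 y) /=; last by rewrite lexx (ltW xy).
rewrite mobiusE (lt_eqF xy) xy addrC.
rewrite (eq_bigl (fun z => (x <= z)%O && (z < y)%O)) ?subrr // => z.
by rewrite lt_neqAle andbC andbCA.
Qed.

(** Weisner's theorem, with [joina x] standing for the join of [x] and [a], so
    that only joins with [a] need to exist. Summing the left-hand sides over
    all [v] in the interval from [a] to [u] gives the sum of [mobius b x] over
    all [x] below [u], which is zero; by induction the terms with [v < u]
    vanish, hence so does the one with [v = u]. *)
Lemma weisner (b a : T) (joina : T -> T) :
    (forall x, b <= x)%O -> (b < a)%O ->
    (forall x u, (joina x <= u)%O = (x <= u)%O && (a <= u)%O) ->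
  forall u, (a <= u)%O -> \sum_(x | joina x == u) mobius b x = 0.
Proof.
move=> b_le b_lt_a joinaP u.
have joina_ge x : (x <= joina x)%O && (a <= joina x)%O by rewrite -joinaP.
have [m] := ubnP #|[pred t : T | t <= u]%O|.
elim: m u => // m IHm u; rewrite ltnS => um au.
(* Below [u], the fibers of [joina] are complete: [x] lies below its join. *)
have fiberE v : (v <= u)%O ->
    \sum_(x | [&& b <= x, x <= u & joina x == v]%O) mobius b x
      = \sum_(x | joina x == v) mobius b x.
  move=> vu; apply: eq_bigl => x; rewrite b_le /=.
  case: eqP => [jx | _]; rewrite ?andbF // andbT.
  by have /andP[xj _] := joina_ge x; rewrite (le_trans xj) // jx.
have := sum_mobius_interval (lt_le_trans b_lt_a au).
rewrite (partition_big joina (fun v => (a <= v)%O && (v <= u)%O)) /=; last first.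
  by move=> x /andP[_ xu]; rewrite joinaP xu au; case/andP: (joina_ge x) => _ ->.
rewrite (bigD1 u) /=; last by rewrite au lexx.
rewrite [X in _ + X]big1 ?addr0 => [sum0 | v /andP[/andP[av vu] vNu]].
  by rewrite -[RHS]sum0 -fiberE //; apply: eq_bigl => x; rewrite andbA.
have v_lt_u : (v < u)%O by rewrite lt_neqAle vNu.
rewrite -[RHS](IHm v) ?(leq_trans (card_lt_down v_lt_u)) // -fiberE //.
by apply: eq_bigl => x; rewrite andbA.
Qed.

End Weisner.

(** * Vectors of small weight *)

Section LightVectors.
Variables (F : finFieldType) (n d : nat).
Implicit Types (v a : 'rV[F]_n) (U : {vspace 'rV[F]_n}).

Definition light : {set 'rV[F]_n} := [set v | hamming_weight v <= d]%N.

(** A light vector is determined by its support, for which there are at most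
    [2 ^ n] choices, and by its values on that support. *)
Lemma card_light : (#|light| <= 2 ^ n * #|F| ^ d)%N.
Proof.
have F_gt0 : (0 < #|F|)%N by apply: ltnW; apply: finNzRing_gt1.
pose supp v := [set j | v 0 j != 0].
rewrite -sum1_card (partition_big supp (fun=> true)) //=.
have -> : (2 ^ n * #|F| ^ d = \sum_(S : {set 'I_n}) #|F| ^ d)%N.
  by rewrite sum_nat_const -[n in LHS]card_ord -cardsT -card_powerset
     powersetT cardsT.
apply: leq_sum => S _.
have [Sd | dS] := leqP #|S| d; last first.
  rewrite big_pred0 // => v; rewrite inE /hamming_weight -/(supp v).
  by apply/andP => -[vd /eqP vS]; move: dS; rewrite -vS ltnNge vd.
apply: leq_trans (leq_pexp2l F_gt0 Sd).
rewrite sum1_card -(card_pffun_on (0 : F) (mem S) predT).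
pose f v : {ffun 'I_n -> F} := [ffun j => v 0 j].
have f_inj : injective f.
  move=> v w /ffunP vw; apply/rowP => j.
  by have := vw j; rewrite !ffunE.
rewrite -(card_image f_inj); apply: subset_leq_card; apply/subsetP => g.
case/imageP => v; rewrite inE => /andP[_ /eqP <-] ->.
apply/pffun_onP; split=> //.
by apply/subsetP => j; rewrite !inE ffunE.
Qed.

Lemma has_light_basisP U :
  reflect (exists2 X : seq 'rV[F]_n, basis_of U X & {subset X <= light})
          (has_light_basis d U).
Proof.
apply: (iffP existsP) => [[X /andP[UX /allP lX]] | [X UX lX]].
  by exists X => // v /lX; rewrite inE.
have szX : size X == \dim U by rewrite (size_basis (X := in_tuple X)).
exists (Tuple szX); rewrite UX; apply/allP => v /lX.
by rewrite inE.
Qed.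

(** This makes joins with a light line in the lattice agree with sums of
    subspaces. *)
Lemma has_light_basis_add_line U a :
  has_light_basis d U -> a \in light -> has_light_basis d (U + <[a]>)%VS.
Proof.
move=> lU la; have [aU | aNU] := boolP (a \in U).
  by rewrite (addv_idPl _) // -memvE.
have [X /andP[/eqP UX fX] lX] := has_light_basisP _ lU.
apply/has_light_basisP; exists (a :: X) => [|v]; last first.
  by rewrite inE => /predU1P[-> //|/lX].
by apply/andP; rewrite span_cons UX addvC eqxx free_cons UX aNU.
Qed.

End LightVectors.

(** * Coatoms and covers in the lattice *)

Section Covers.
Variables (F : finFieldType) (n d : nat).
Implicit Types (H U V : hwdl F n d) (a v : 'rV[F]_n).

Definition add_line V a (la : a \in light F n d) : hwdl F n d :=
  Hwdl (has_light_basis_add_line (valP V) la).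

Definition covers H : {set hwdl F n d} :=
  [set U : hwdl F n d | (H <= U)%VS && (\dim U == (\dim H).+1)].

(** Some member of a light basis of [U] escapes [V]. With [V] the zero space
    this provides an atom below a nonzero [U]. *)
Lemma exists_light_notin U V :
  ~~ (U <= V)%VS -> exists a, [/\ a \in light F n d, a \in U & a \notin V].
Proof.
have [X /andP[/eqP <- _] lX] := has_light_basisP _ _ (valP U) => UV.
have /allPn[a aX aNV] : ~~ all (fun a => a \in (V : {vspace _})) X.
  by apply: contra UV => /allP XV; apply/span_subvP.
by exists a; split=> //; [apply: lX | apply: memv_span].
Qed.

Lemma hwdl_leE U V : (U <= V)%O = (hwdl_space U <= hwdl_space V)%VS.
Proof. by []. Qed.

(** Weisner's theorem for a light line [L] below [U]: every [H <> U] with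
    [H + L = U] has codimension one in [U], because [L] has dimension one. *)
Lemma abs_mobius_le U i : \dim U = i.+1 ->
  (`|mobius (hwdl0 F n d) U|
     <= \sum_(H : hwdl F n d | (H <= U)%VS && (\dim H == i))
          `|mobius (hwdl0 F n d) H|)%N.
Proof.
move=> dimU.
have [a [la aU a0]] : exists a, [/\ a \in light F n d, a \in U & a \notin hwdl0 F n d].
  apply: exists_light_notin; apply/negP => /dimvS.
  by rewrite dimU dimv0.
pose L := add_line (hwdl0 F n d) la.
have LE : L = <[a]>%VS :> {vspace _} by rewrite /= add0v.
have lt0L : (hwdl0 F n d < L)%O.
  rewrite lt_def hwdl_le0 andbT; apply: contra a0 => /eqP <-.
  by rewrite LE memv_line.
have joinP x u : (add_line x la <= u)%O = (x <= u)%O && (L <= u)%O.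
  by rewrite !hwdl_leE LE subv_add.
have LU : (L <= U)%O by rewrite hwdl_leE LE -memvE.
have := weisner (@hwdl_le0 F n d) lt0L joinP LU.
have UU : add_line U la == U.
  by rewrite eq_le joinP lexx LU; have := lexx (add_line U la); rewrite joinP => /andP[].
(* The term of index [U] is isolated from the others, which are coatoms. *)
rewrite (bigD1 U) //= => /eqP; rewrite addr_eq0 => /eqP ->.
rewrite abszN; apply: leq_trans (leq_absz_sum _ _) _.
rewrite [leqLHS]big_mkcond [leqRHS]big_mkcond; apply: leq_sum => H _.
case: andP => // -[/eqP HL HU]; rewrite -HL in HU dimU *.
have HsubL : (H <= add_line H la)%VS by apply: addvSl.
have dimH_lt : (\dim H < i.+1)%N.
  rewrite -dimU ltn_neqAle dimvS // andbT; apply: contra HU => /eqP eqd.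
  by apply/eqP/val_inj/eqP; rewrite eqEdim HsubL eqd /=.
have : (\dim (H + <[a]>) <= \dim H + \dim <[a]>)%N by apply: dimv_add_leqif.
rewrite [\dim (H + _)]dimU dim_vline => dimH_ge.
have -> : \dim H == i.
  by rewrite eqn_leq -[(_ <= i)%N]ltnS dimH_lt; case: (a != 0) dimH_ge => /=; lia.
by rewrite HsubL.
Qed.

Section Counting.
Implicit Type A : {set 'rV[F]_n}.

(** Both covers are equal to [H + <[a]>]. *)
Lemma covers_unique H U V a :
    (H <= U)%VS -> (H <= V)%VS -> \dim U = (\dim H).+1 -> \dim V = (\dim H).+1 ->
  a \in U -> a \in V -> a \notin H -> U = V.
Proof.
move=> HU HV dU dV aU aV aH.
have gen W : (H <= W)%VS -> \dim W = (\dim H).+1 -> a \in W ->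
    (H + <[a]>)%VS = W :> {vspace _}.
  move=> HW dW aW; apply/eqP; rewrite eqEdim subv_add HW -memvE aW dW /=.
  rewrite ltn_neqAle dimvS ?addvSl // andbT; apply: contra aH => /eqP eqd.
  have /eqP -> : (H == H + <[a]> :> {vspace _})%VS by rewrite eqEdim addvSl eqd /=.
  by rewrite memvE addvSr.
by apply: val_inj; rewrite /= -(gen U) // (gen V).
Qed.

(** By [covers_unique] the sets [U :\: H], for [U] covering [H], are disjoint,
    and each of them uses up at least [k] elements of [A]. *)
Lemma leq_card_covers H A k :
    (forall U, (H <= U)%VS -> \dim U = (\dim H).+1 ->
       k <= #|[set v in A | (v \in U) && (v \notin H)]|)%N ->
  (#|covers H| * k <= #|A|)%N.
Proof.
move=> k_le.
pose fib U := [set v in A | (v \in (U : {vspace _})) && (v \notin (H : {vspace _}))].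
have -> : (#|covers H| * k = \sum_(U in covers H) k)%N by rewrite sum_nat_const.
apply: (@leq_trans (\sum_(U in covers H) #|fib U|)).
  by apply: leq_sum => U; rewrite inE => /andP[HU /eqP dU]; apply: k_le.
have disj U V v : U \in covers H -> V \in covers H -> v \in fib U -> v \in fib V -> U = V.
  rewrite !inE => /andP[HU /eqP dU] /andP[HV /eqP dV].
  move=> /and3P[_ vU vH] /and3P[_ vV _].
  exact: (covers_unique HU HV dU dV vU vV vH).
(* Double counting: each [v] in [A] lies in at most one of the sets [fib U]. *)
rewrite (eq_bigr (fun U => \sum_(v in A) (v \in fib U))%N); last first.
  move=> U _; rewrite -sum1_card big_mkcond [in RHS]big_mkcond /=.
  by apply: eq_bigr => v _; rewrite !inE; case: (v \in A) => //=; case: andb.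
rewrite exchange_big -sum1_card; apply: leq_sum => v _ /=.
have [U /andP[Uc vU] | none] := pickP [pred U | (U \in covers H) && (v \in fib U)].
  rewrite (bigD1 U) //= big1 ?addn0 ?leq_b1 // => V /andP[Vc VU].
  by apply/eqP; rewrite eqb0; apply: contra VU => vV; rewrite (disj _ _ _ Vc Uc vV vU).
rewrite big1 // => U Uc; apply/eqP; rewrite eqb0; apply/negP => vU.
by have := none U; rewrite /= Uc vU.
Qed.

(** A cover of [H] contains a light vector outside [H], and with it the
    [#|F| - 1] nonzero multiples of that vector, which are light and outside [H].
    The factor 2 pays for the replacement of [#|F| - 1] by [#|F|]. *)
Lemma leq_card_covers_light H :
  (#|covers H| * #|F| <= 2 ^ n.+1 * #|F| ^ d)%N.
Proof.
have F_gt1 : (1 < #|F|)%N by apply: finNzRing_gt1.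
have := @leq_card_covers H (light F n d) #|F|.-1.
have fib_ge U : (H <= U)%VS -> \dim U = (\dim H).+1 ->
    (#|F|.-1 <= #|[set v in light F n d | (v \in U) && (v \notin H)]|)%N.
  move=> HU dU.
  have [|a [la aU aH]] := @exists_light_notin U H.
    by apply/negP => /dimvS; rewrite dU ltnn.
  rewrite -(cardC1 (0 : F)).
  have a0 : a != 0 by apply: contraNneq aH => ->; apply: mem0v.
  have inj : injective (fun c : F => c *: a).
    move=> c e /eqP; rewrite -subr_eq0 -scalerBl scaler_eq0.
    by rewrite (negPf a0) orbF subr_eq0 => /eqP.
  rewrite -(card_image inj); apply: subset_leq_card; apply/subsetP => v.
  case/imageP => c; rewrite !inE => c0 ->.
  rewrite memvZ // rpredZeq (negPf c0) /= aH andbT.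
  by move: la; rewrite inE; apply: leq_trans; apply: subset_leq_card;
    apply/subsetP => j; rewrite !inE mxE mulf_eq0 negb_or => /andP[].
move=> /(_ fib_ge) /leq_trans /(_ (card_light F n d)) bound.
have : (#|F| <= 2 * #|F|.-1)%N by lia.
move=> le2; apply: leq_trans (leq_mul (leqnn _) le2) _.
by rewrite mulnCA expnS -mulnA leq_mul2l.
Qed.

(** If [h] is the dimension of [H], each cover has [#|F| ^ h.+1 - #|F| ^ h]
    vectors outside [H], at least half of [#|F| ^ h.+1]. *)
Lemma leq_card_covers_all H :
  (#|covers H| * #|F| ^ (\dim H).+1 <= 2 * #|F| ^ n)%N.
Proof.
have F_gt1 : (1 < #|F|)%N by apply: finNzRing_gt1.
set h := \dim H.
have := @leq_card_covers H setT (#|F| ^ h.+1 - #|F| ^ h)%N.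
have fib_ge U : (H <= U)%VS -> \dim U = h.+1 ->
    (#|F| ^ h.+1 - #|F| ^ h
       <= #|[set v in [set: 'rV[F]_n] | (v \in U) && (v \notin H)]|)%N.
  move=> HU dU; rewrite -dU -!card_vspace.
  have sub : [set v in U] :\: [set v in H]
      \subset [set v in [set: 'rV[F]_n] | (v \in U) && (v \notin H)].
    by apply/subsetP => v; rewrite !inE andbC.
  apply: leq_trans (subset_leq_card sub); rewrite cardsD -[X in (X - _)%N]cardsE.
  by rewrite leq_sub2l // -[leqRHS]cardsE subset_leq_card // subsetIr.
move=> /(_ fib_ge); rewrite cardsT card_mx mul1n => bound.
have le2 : (#|F| ^ h.+1 <= 2 * (#|F| ^ h.+1 - #|F| ^ h))%N.
  have : (2 * #|F| ^ h <= #|F| ^ h.+1)%N by rewrite expnS leq_mul2r F_gt1 orbT.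
  by lia.
by apply: leq_trans (leq_mul (leqnn _) le2) _; rewrite mulnCA leq_mul2l.
Qed.

End Counting.

(** * Absolute Whitney numbers *)

Definition abs_whitney i : nat :=
  (\sum_(U : hwdl F n d | \dim U == i) `|mobius (hwdl0 F n d) U|)%N.

(** A bound on the number of covers, in the form [m / k], bounds the growth of
    the absolute Whitney numbers: sum [abs_mobius_le] over [U] and exchange the
    order of summation. *)
Lemma abs_whitney_succ (i k m : nat) :
    (forall H, \dim H = i -> #|covers H| * k <= m)%N ->
  (abs_whitney i.+1 * k <= abs_whitney i * m)%N.
Proof.
move=> covers_le.
apply: (@leq_trans ((\sum_(U : hwdl F n d | \dim U == i.+1)
   \sum_(H : hwdl F n d | (\dim H == i) && (H <= U)%VS) `|mobius (hwdl0 F n d) H|) * k)%N).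
  rewrite leq_mul2r; apply/orP; right; apply: leq_sum => U /eqP dU.
  apply: leq_trans (abs_mobius_le dU) _.
  by apply: eq_leq; apply: eq_bigl => H; rewrite andbC.
rewrite (exchange_big_dep (fun H => \dim H == i)) /=; last by move=> U H _ /andP[].
rewrite !big_distrl /=; apply: leq_sum => H dH.
rewrite (eq_bigl (fun U => U \in covers H)).
  rewrite sum_nat_const mulnAC mulnC leq_mul //.
  exact/covers_le/eqP.
by move=> U; rewrite !inE dH (eqP dH) andbC.
Qed.

Lemma abs_whitney0 : abs_whitney 0 = 1%N.
Proof.
rewrite /abs_whitney (big_pred1 (hwdl0 F n d)) => [|U]; first by rewrite mobiusE eqxx.
by rewrite dimv_eq0.
Qed.

Lemma abs_whitney_bound i : (0 < d)%N -> (d + 2 <= n)%N -> (2 <= i)%N ->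
  (abs_whitney i * #|F| ^ 'C(i + 1, 2)
     <= 2 ^ (2 * n + i) * #|F| ^ (d - 1 + n * (i - 1)))%N.
Proof.
move=> hd hn; have F_gt0 : (0 < #|F|)%N by apply: ltnW; apply: finNzRing_gt1.
case: i => [|[|i]] // _.
elim: i => [|i IHi].
  have := abs_whitney_succ (i := 0) (fun H _ => leq_card_covers_light H).
  have := abs_whitney_succ (i := 1) (fun H _ => leq_card_covers_light H).
  rewrite abs_whitney0 mul1n; set q := #|F|; set B := (_ * q ^ d)%N => le2 le1.
  have le_B : (abs_whitney 2 * q ^ 2 <= B * B)%N.
    rewrite -mulnn mulnA; apply: leq_trans (leq_mul le2 (leqnn q)) _.
    by rewrite mulnAC leq_mul2r le1 orbT.
  rewrite (_ : 'C(0.+2 + 1, 2) = 3%N) // expnSr mulnA.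
  apply: leq_trans (leq_mul le_B (leqnn q)) _.
  (* The exponents of [q] are 2d + 1 and d - 1 + n. *)
  rewrite /B mulnACA -!expnD -mulnA -expnSr.
  by apply: leq_mul; [rewrite leq_exp2l | rewrite leq_pexp2l]; lia.
have := abs_whitney_succ (i := i.+2) (k := (#|F| ^ i.+3)%N) (m := (2 * #|F| ^ n)%N).
have covers_le H : \dim H = i.+2 -> (#|covers H| * #|F| ^ i.+3 <= 2 * #|F| ^ n)%N.
  by move=> <-; apply: leq_card_covers_all.
move=> /(_ covers_le) le_succ.
rewrite !addn1 in IHi *.
rewrite binS bin1 addnC expnD mulnA.
apply: leq_trans (leq_mul le_succ (leqnn _)) _.
rewrite mulnAC; apply: leq_trans (leq_mul IHi (leqnn _)) _.
rewrite mulnACA -expnSr -expnD.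
by apply: leq_mul; rewrite leq_pexp2l //; lia.
Qed.

End Covers.

Theorem theorem10p4 (n d i : nat) (hd : (2 <= d)%N) (hn : (d + 2 <= n)%N)
    (hi : (2 <= i <= n)%N) :
  exists (C : rat) (q0 : nat), forall F : finFieldType, (q0 <= #|F|)%N ->
    `|whitney F n d i|%:~R <=
      C * #|F|%:R ^ (d%:Z - 1 + n%:Z * (i%:Z - 1) - 'C(i + 1, 2)%:Z).
Proof.
exists (2 ^ (2 * n + i))%N%:R, 0%N => F _.
have F_gt0 : (0 < #|F|%:R :> rat) by rewrite ltr0n; apply: ltnW; apply: finNzRing_gt1.
rewrite expfzDr ?gt_eqF // -exprnN mulrA ler_pdivlMr ?exprn_gt0 //.
have -> : d%:Z - 1 + n%:Z * (i%:Z - 1) = (d - 1 + n * (i - 1))%N by lia.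
have [i2 _] := andP hi.
apply: le_trans (_ : (abs_whitney F n d i * #|F| ^ 'C(i + 1, 2))%N%:R <= _).
  rewrite natrM natrX; apply: ler_wpM2r; first exact/exprn_ge0/ltW.
  by rewrite -abszE -pmulrn ler_nat leq_absz_sum.
by rewrite -exprnP -natrX -natrM ler_nat abs_whitney_bound // ltnW.
Qed.
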